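(* Let $G$ be a group and let $\sigma,\tau$ be topologies on $G$ such that $(G,\sigma)$ is a $T_2$ precompact topological group, $(G,\tau)$ is a weakly semiregular semitopological group and $\tau\subset\sigma$. Then $(G,\tau)$ is a topological group.
   Context: A semitopological group is a group $G$ endowed with a topology such that the multiplication map $G\times G\to G$, $(x,y)\mapsto xy$, is separately continuous. A topological group is a group with a topology for which the multiplication $G\times G\to G$ is (jointly) continuous and the inversion $x\mapsto x^{-1}$ is continuous. A topological group $G$ is precompact if for each neighborhood $U$ of the unit of $G$ there exists a finite subset $F$ of $G$ such that $FU=G$ (equivalently, $UF=G$). A topological space $X$ is weakly semiregular if it has a base consisting of regular open sets, i.e. sets $U$ with $U=\operatorname{int}\overline{U}$. $T_2$ means Hausdorff. No separation axioms are assumed unless stated; in particular, topological groups are not assumed to be Hausdorff. *)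

(* Defs.v *)
From HB Require Import structures.
From mathcomp Require Import all_boot.
From mathcomp Require Import boolp classical_sets cardinality topology.

Set Implicit Arguments.
Unset Strict Implicit.
Unset Printing Implicit Defensive.

Local Open Scope classical_set_scope.
Local Open Scope group_scope.

(* A group with a topology, without any compatibility between the two. *)
#[short(type="groupWithTopologyType")]
HB.structure Definition GroupWithTopology := {G of Group G & Topological G}.

Record topology (X : Type) := Topology {
  opens : set_system X;
  opens_setT : opens setT;
  opens_setI : setI_closed opens;
  opens_bigcup : forall F : set_system X,
    F `<=` opens -> opens (\bigcup_(A in F) A) }.

(* The type [X], carrying the topology [t] instead of any canonical one: this
   is what allows a single type to bear several topologies. *)
Definition with_topology (X : Type) (t : topology X) : Type := X.

Section WithTopology.
Context (X : choiceType) (t : topology X).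

HB.instance Definition _ := Choice.on (with_topology t).

Let opens_bigcup_family (I : Type) (f : I -> set X) :
  (forall i, opens t (f i)) -> opens t (\bigcup_i f i).
Proof.
move=> tf; have -> : \bigcup_i f i = \bigcup_(A in range f) A.
  by rewrite bigcup_image.
by apply: opens_bigcup => _ [i _ <-].
Qed.

HB.instance Definition _ := isOpenTopological.Build (with_topology t)
  (@opens_setT _ t) (@opens_setI _ t) opens_bigcup_family.

Lemma open_with_topology : @open (with_topology t) = opens t.
Proof. by []. Qed.

End WithTopology.

HB.instance Definition _ (G : groupType) (t : topology G) :=
  Group.on (with_topology t).

Definition semitopological_group (G : groupWithTopologyType) : Prop :=
  forall a : G, continuous (fun x : G => a * x) /\
                continuous (fun x : G => x * a).

Definition topological_group (G : groupWithTopologyType) : Prop :=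
  continuous (fun p : G * G => p.1 * p.2) /\
  continuous (fun x : G => x^-1).

(* Not to be confused with [precompact], which means relatively compact. *)
Definition group_precompact (G : groupWithTopologyType) : Prop :=
  forall U : set G, nbhs (1 : G) U ->
    exists2 F : set G, finite_set F &
      [set x * u | x in F & u in U] = [set: G].

Definition weakly_semiregular (X : topologicalType) : Prop :=
  exists2 B : set_system X, basis B & B `<=` @regopen X.

(* Main.v *)
Require Import Defs.
From mathcomp Require Import all_boot.
From mathcomp Require Import boolp classical_sets cardinality topology.

(** Write [O] for neighbourhoods of the unit in [sigma], [V] and [W] for those
in [tau]. The idea is best seen in the compact group K that completes
(G, sigma). There the intersection H of the closures of all the [V] is a closed
subsemigroup, hence a subgroup, because a closed subsemigroup of a compact
group is a group; and by compactness every [O]H contains some [V]. If [U] is a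
regular open [tau]-neighbourhood of 1 and [O] is open and small enough, then
[O]H, cut down to G, is [tau]-open and lies in the [tau]-closure of [U], hence
in [U]. So the traces of the [O]H form a neighbourhood base of 1 in [tau], and
this base is the one of a group topology.

The proof below says the same without the completion, replacing compactness by
finite covers by translates:
- [precompact_filter_stable], that is, V is within O of H: for each [O] some
  [V] is contained in [O][W] for every [W], however small;
- [precompact_filter_invg], that is, H is closed under inversion: for each [O]
  some [V] is such that each of its points has, in every [W], an inverse up to
  [O]. It rests on [closure1_recurrent], which plays the role of the recurrence
  of powers in a compact group;
- [regopen_absorbs]: a regular [tau]-open [U] containing 1 contains some [O][V].

Joint continuity of the product at 1 follows: given [O][V] inside [U], choose
[W] within [O] of every [tau]-neighbourhood; for [x] in [W] and [y] in [V] the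
point [x] can be replaced, up to a factor in [O], by some [w] so close to 1 that
[w * y] stays in [V]. Continuity of the inverse then comes from the approximate
inverses, the error being absorbed as every [V] is also a
[sigma]-neighbourhood. *)

Set Implicit Arguments.
Unset Strict Implicit.
Unset Printing Implicit Defensive.

Local Open Scope classical_set_scope.
Local Open Scope group_scope.

Lemma near_all_in (I : eqType) (T : Type) (F : set_system T) (s : seq I)
    (P : I -> set T) : Filter F ->
  (forall i, i \in s -> F (P i)) -> F [set t | forall i, i \in s -> P i t].
Proof.
move=> FF; elim: s => [|j s IHs] FP; first by apply: filterS filterT.
have FPj : F (P j) by apply: FP; rewrite mem_head.
have FPs := IHs (fun i si => FP i (mem_behead (s := j :: s) si)).
by apply: filterS2 FPj FPs => t Pjt Pst i; rewrite inE => /predU1P[->|/Pst].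
Qed.

Lemma nbhs_open_subset (X : topologicalType) (x : X) (U : set X) :
  nbhs x U -> exists V, [/\ open V, V x, nbhs x V & V `<=` U].
Proof.
rewrite {1}nbhsE => -[V xV VU]; exists V; have [oV Vx] := xV; split=> //.
exact: open_nbhs_nbhs.
Qed.

Section PrecompactGroup.
Variable S : groupWithTopologyType.
Hypothesis S_group : topological_group S.
Hypothesis S_precompact : group_precompact S.

Lemma nbhs1V (O : set S) : nbhs (1 : S) O -> nbhs (1 : S) [set x | O x^-1].
Proof.
by have [_ invc] := S_group => O1; apply: (invc 1); rewrite /= invg1.
Qed.

Lemma nbhs1_mul (O : set S) : nbhs (1 : S) O ->
  exists2 O', nbhs (1 : S) O' & forall x y, O' x -> O' y -> O (x * y).
Proof.
move=> O1; have [mulc _] := S_group.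
have [|[A B] /= [A1 B1] AB] := mulc (1, 1) O; first by rewrite /= mulg1.
by exists (A `&` B) => [|x y [Ax _] [_ By]]; [exact: filterI | exact: (AB (x, y))].
Qed.

Lemma nbhs1_div (O : set S) : nbhs (1 : S) O ->
  exists2 O', nbhs (1 : S) O' & forall x y, O' x -> O' y -> O (x * y^-1).
Proof.
move=> /nbhs1_mul[O' O'1 O'O]; exists (O' `&` [set x | O' x^-1]).
  by apply: filterI => //; exact: nbhs1V.
by move=> x y [Ox _] [_ Oy]; exact: O'O.
Qed.

Lemma precompact_cover (O : set S) : nbhs (1 : S) O ->
  exists (F : seq S) (f : S -> S), forall x, f x \in F /\ O ((f x)^-1 * x).
Proof.
move=> /S_precompact[_ /finite_seqP[F ->] FO].
suff /choice[f fP] : forall x, exists y, y \in F /\ O (y^-1 * x) by exists F, f.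
move=> x; have : [set: S] x by [].
by rewrite -FO => -[y Fy [u Ou <-]]; exists y; rewrite mulKg.
Qed.

(** Take a long sequence in which each new term is p * w, with p the last term
and [w] provided by the hypothesis for the quotients q^-1 * p of the earlier
terms q. All quotients y^-1 * x of a later term x by an earlier y then lie in
[B], while two terms falling into the same translate of a small neighbourhood
have a quotient close to 1. *)
Lemma closure1_recurrent (B : set S) :
  (forall s : seq S, (forall x, x \in s -> B x) ->
    exists2 w, B w & forall x, x \in s -> B (x * w)) ->
  closure B (1 : S).
Proof.
move=> Brec O O1; apply: contrapT => BO.
have [O' O'1 O'O] := nbhs1_div O1.
have [F [f fP]] := precompact_cover (nbhs1V O'1).
pose R x y := `[< B (y^-1 * x) >].
(* The latest term comes first. *)
have chain n : exists p s, size s = n /\ pairwise R (p :: s).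
  elim: n => [|n [p [s [sz /= /andP[ps ss]]]]]; first by exists 1, [::].
  have [|w Bw Bsw] := Brec [seq q^-1 * p | q <- s].
    by move=> _ /mapP[q qs ->]; have /asboolP := allP ps _ qs.
  exists (p * w), (p :: s); split; first by rewrite /= sz.
  rewrite /= ps ss !andbT; apply/andP; split; first by apply/asboolP; rewrite mulKg.
  apply/allP => q qs; apply/asboolP; rewrite mulgA; apply: Bsw.
  by apply/mapP; exists q.
have [p [s [sz ps]]] := chain (size F).
have : (size [seq f x | x <- p :: s] <= size F)%N.
  apply: uniq_leq_size => [|_ /mapP[x _ ->]]; last by have [] := fP x.
  rewrite uniq_pairwise pairwise_map; apply: sub_pairwise ps => x y /asboolP Byx.
  apply/eqP => /= fxy; apply: BO; exists (y^-1 * x); split=> //.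
  have [_ /= Ox] := fP x; have [_ /= Oy] := fP y.
  by have := O'O _ _ Oy Ox; rewrite invgK fxy invgM invgK mulgA mulgK.
by rewrite size_map /= sz ltnn.
Qed.

(** Cover S by finitely many translates O' * y^-1, where the quotients
a * b^-1 of points of O' lie in [O]. As the members of [N] shrink, fewer of these sets meet them, so some
member meets only those that all members meet. *)
Lemma precompact_filter_stable (N : set_system S) (O : set S) :
  Filter N -> nbhs (1 : S) O ->
  exists2 V, N V &
    forall W, N W -> V `<=` [set o * w | o in O & w in W].
Proof.
move=> FN O1; have [O' O'1 O'O] := nbhs1_div O1.
have [F [f fP]] := precompact_cover (nbhs1V O'1).
pose far y (x : S) := exists2 W, N W & forall w, W w -> ~ O' (w * y).
pose P y : set S := [set x | far y x -> ~ O' (x * y)].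
exists [set x | forall y, y \in F -> P y x].
  apply: near_all_in => y _.
  have [[W NW WP]|nfar] := EM (far y 1).
    by apply: filterS NW => w Ww _; exact: WP.
  by apply: filterS filterT => x _ [W NW WP]; case: nfar; exists W.
move=> W NW x Px; have [Fy /= Oy] := fP x^-1.
(* Inverting the left cover of [x^-1] places [x] in a right translate. *)
set y := f x^-1 in Fy Oy; have {}Oy : O' (x * y).
  by move: Oy; rewrite invgM !invgK.
have : exists2 w, W w & O' (w * y).
  apply: contrapT => nW; apply: (Px _ Fy) Oy; exists W => // w Ww Ow.
  by apply: nW; exists w.
move=> [w Ww Ow]; exists ((x * y) * (w * y)^-1); first exact: O'O.
by exists w => //; rewrite invgM !mulgA mulgK mulgVK.
Qed.

(** The hypothesis on [N] is that of the neighbourhoods of 1 in a group whose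
left translations are continuous. In the powers of a point v of a compact
group, some v ^+ n.+1 is close to 1, so that v ^+ n is nearly inverse to v and
lies in any closed subsemigroup containing v. Here a product of elements close
to v takes the place of the power, each factor chosen so near to 1, depending on
the previous ones, that the products of later factors remain in W. *)
Lemma precompact_filter_invg (N : set_system S) (O : set S) :
    Filter N ->
    (forall U, N U -> exists V, [/\ N V, V `<=` U, V 1 &
       forall x, V x -> N [set y | V (x * y)]]) ->
    nbhs (1 : S) O ->
  exists2 V, N V & forall W, N W -> forall v, V v -> exists2 w, W w & O (v * w).
Proof.
move=> FN Nopen /nbhs1_mul[O' O'1 O'O].
have [V NV VN] := precompact_filter_stable FN O'1.
exists V => // U /Nopen[W [NW WU W1 Wopen]] v Vv.
(* The first factor is only required to be close to [v]; the remaining ones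
   stay together in [W] and form the approximate inverse. *)
pose A : set S := [set a | O' (v * a^-1)].
pose B := [set a * w | a in A & w in W].
have : closure B 1.
  apply: closure1_recurrent => s sB.
  have : N [set x | forall b, b \in s -> B (b * x)].
    apply: near_all_in => _ /sB[a Aa [w Ww <-]].
    apply: filterS (Wopen _ Ww) => x Wwx; exists a => //; exists (w * x) => //.
    by rewrite mulgA.
  move=> /(filterI NW)/VN/(_ _ Vv)[o Oo [x [Wx Bx] oxv]].
  exists x => //; exists x; first by rewrite /A /= -oxv mulgK.
  by exists 1 => //; rewrite mulg1.
move=> /(_ _ O'1)[_ [[a /= Aa [w Ww <-]] Oaw]].
exists w; first exact: WU.
by have := O'O _ _ Aa Oaw; rewrite mulgA mulgVK.
Qed.

End PrecompactGroup.

Section Semitopological.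
Variable T : groupWithTopologyType.
Hypothesis T_group : semitopological_group T.

Lemma nbhs_mull (a x : T) (U : set T) :
  nbhs (a * x) U -> nbhs x [set y | U (a * y)].
Proof. by have [/(_ x)c _] := T_group a; apply: c. Qed.

Lemma nbhs_mulr (a x : T) (U : set T) :
  nbhs (x * a) U -> nbhs x [set y | U (y * a)].
Proof. by have [_ /(_ x)c] := T_group a; apply: c. Qed.

Lemma nbhs1_left_open_base (U : set T) : nbhs (1 : T) U ->
  exists V, [/\ nbhs (1 : T) V, V `<=` U, V 1 &
    forall x, V x -> nbhs (1 : T) [set y | V (x * y)]].
Proof.
move=> /nbhs_open_subset[V [oV V1 NV VU]]; exists V; split=> // x Vx.
by apply: nbhs_mull; rewrite mulg1; apply: open_nbhs_nbhs; split.
Qed.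

(** Separately continuous translations carry continuity at the unit to every
point: x * y is written as a * (a^-1 * x) * (y * b^-1) * b near (a, b). *)
Lemma topological_group_nbhs1 :
    (forall U, nbhs (1 : T) U -> exists2 V, nbhs (1 : T) V &
       forall x y, V x -> V y -> U (x * y)) ->
    (forall U, nbhs (1 : T) U -> nbhs (1 : T) [set x | U x^-1]) ->
  topological_group T.
Proof.
move=> mul1 inv1; split.
  move=> [a b] U /= Uab.
  have [|V V1 VU] := mul1 [set x | U (a * x * b)].
    apply: (nbhs_mull (U := [set x | U (x * b)])); rewrite mulg1.
    exact: nbhs_mulr.
  exists ([set x | V (a^-1 * x)], [set y | V (y * b^-1)]) => /=.
    by split; [apply: nbhs_mull; rewrite mulVg | apply: nbhs_mulr; rewrite mulgV].
  move=> [x y] /= [Vx Vy]; have := VU _ _ Vx Vy.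
  by rewrite /= !mulgA mulgV mul1g mulgVK.
move=> a U Ua.
have /inv1 /= : nbhs (1 : T) [set x | U (x * a^-1)].
  by apply: nbhs_mulr; rewrite mul1g.
move=> V1; have : nbhs a [set x | U ((a^-1 * x)^-1 * a^-1)].
  by apply: (nbhs_mull (U := [set x | U (x^-1 * a^-1)])); rewrite mulVg.
by apply: filterS => x /=; rewrite invgM invgK mulgK.
Qed.

End Semitopological.

Section Coarser.
Variables (G : groupType) (sigma tau : topology G).
Local Notation S := (with_topology sigma).
Local Notation T := (with_topology tau).
Hypothesis sigma_group : topological_group S.
Hypothesis sigma_precompact : group_precompact S.
Hypothesis tau_group : semitopological_group T.
Hypothesis tau_sigma : opens tau `<=` opens sigma.

Lemma nbhs_coarser (x : G) (U : set G) : nbhs (x : T) U -> nbhs (x : S) U.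
Proof.
move=> /nbhs_open_subset[V [/tau_sigma oV Vx _ VU]].
by rewrite nbhsE; exists V.
Qed.

(** The union of the translates o * V is open for [tau], so it is enough to
place it in the [tau]-closure of [U]: for [w] close to 1 and nearly inverse to
v, the point o * v * w is close to o * v in [tau] and close to 1 in [sigma],
hence in [U]. *)
Lemma regopen_absorbs (U : set G) : @regopen T U -> U 1 ->
  exists O V : set G, [/\ nbhs (1 : S) O, nbhs (1 : T) V &
    forall o v, O o -> V v -> U (o * v)].
Proof.
move=> Ureg U1.
have oU : @open T U by rewrite -Ureg; exact: open_interior.
have US : nbhs (1 : S) U by apply: nbhs_coarser; apply: open_nbhs_nbhs; split.
have [O O1 OU] := nbhs1_mul sigma_group US.
have [V' V'1 V'O] := precompact_filter_invg sigma_group sigma_precompact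
  (nbhs_filter (1 : T)) (nbhs1_left_open_base tau_group) O1.
have [V [oV V1 NV VV']] := nbhs_open_subset V'1.
exists O, V; split=> // o v Oo Vv.
(* The whole translate o * V lies in the closure of [U]. *)
rewrite -Ureg; apply: (@filterS _ (nbhs (o * v : T)) _ [set x | V (o^-1 * x)]).
  move=> x Vx B Bx.
  have W1 : nbhs (1 : T) [set w | B (x * w)].
    by apply: (nbhs_mull tau_group); rewrite mulg1.
  have [w Bw Ow] := V'O _ W1 _ (VV' _ Vx).
  exists (x * w); split=> //.
  by have := OU _ _ Oo Ow; rewrite /= !mulgA mulgV mul1g.
by apply: (nbhs_mull tau_group); rewrite mulKg; apply: open_nbhs_nbhs; split.
Qed.

Lemma topological_group_coarser :
  weakly_semiregular T -> topological_group T.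
Proof.
move=> [R [_ Rbase] Rreg].
have absorb (U : set G) : nbhs (1 : T) U ->
    exists O V : set G, [/\ nbhs (1 : S) O, nbhs (1 : T) V &
      forall o v, O o -> V v -> U (o * v)].
  move=> /Rbase[U' [RU' U'1] U'U].
  have [O [V [O1 V1 OV]]] := regopen_absorbs (Rreg _ RU') U'1.
  by exists O, V; split=> // o v Oo Vv; apply/U'U/OV.
have mul1 (U : set T) : nbhs (1 : T) U -> exists2 V, nbhs (1 : T) V &
    forall x y : T, V x -> V y -> U (x * y).
  move=> /absorb[O [V' [O1 V'1 OV]]].
  have [V [oV V1 NV VV']] := nbhs_open_subset V'1.
  have [W W1 WN] := precompact_filter_stable sigma_group sigma_precompact
    (nbhs_filter (1 : T)) O1.
  exists (W `&` V); first exact: filterI.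
  move=> x y [Wx _] [_ Vy].
  have /WN/(_ _ Wx)[o Oo [w Vwy <-]] : nbhs (1 : T) [set w | V (w * y)].
    by apply: (nbhs_mulr tau_group); rewrite mul1g; apply: open_nbhs_nbhs; split.
  by rewrite -mulgA; apply: OV => //; exact: VV'.
apply: topological_group_nbhs1 => // U /mul1[V V1 VU].
(* x^-1 = w * (x * w)^-1, and (x * w)^-1 lies in [V]. *)
have O1 := nbhs1V sigma_group (nbhs_coarser V1).
have [W W1 WV] := precompact_filter_invg sigma_group sigma_precompact
  (nbhs_filter (1 : T)) (nbhs1_left_open_base tau_group) O1.
apply: filterS W1 => x /(WV _ V1)[w Vw Vxw].
by have := VU _ _ Vw Vxw; rewrite /= invgM mulVKg.
Qed.

End Coarser.

Theorem proposition5 (G : groupType) (sigma tau : topology G)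
    (sigma_group : topological_group (with_topology sigma))
    (sigma_T2 : hausdorff_space (with_topology sigma))
    (sigma_precompact : group_precompact (with_topology sigma))
    (tau_group : semitopological_group (with_topology tau))
    (tau_semiregular : weakly_semiregular (with_topology tau))
    (tau_sigma : opens tau `<=` opens sigma) :
  topological_group (with_topology tau).
Proof. exact: (topological_group_coarser (sigma := sigma)). Qed.
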